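(* Let $R=R(S,\kappa)$ be a near-integral fusion ring. There exist exactly two ring homomorphisms $\chi_\pm:R(S,\kappa)\to\mathbb{C}$ such that $\chi_\pm(\rho)\neq0$. In particular, $\chi_\pm|_S=\mathrm{FPdim}$ and $\chi_\pm(\rho)=d_\pm$.
   Context: A fusion ring $(R,B)$ is a unital associative ring $R$, free as a $\mathbb{Z}$-module with finite basis $B=\{1_R=b_1,\ldots,b_n\}$, such that $b_ib_j=\sum_k c_{ij}^kb_k$ with $c_{ij}^k\in\mathbb{Z}_{\geq0}$, together with an involution $\ast$ of $\{1,\ldots,n\}$ such that $\sum_ja_jb_j\mapsto\sum_ja_jb_{j^\ast}$ is an antiautomorphism of $R$ and $c_{ij}^1=1$ if $i=j^\ast$ and $0$ otherwise. $\mathrm{FPdim}:R\to\mathbb{C}$ is the ring homomorphism sending each $b_i\in B$ to the maximal real eigenvalue of $[c_{ij}^k]_{j,k}$, and $\mathrm{FPdim}(R):=\sum_{b\in B}\mathrm{FPdim}(b)^2$. A fusion subring is a fusion ring $(S,C)$ with $C\subseteq B$ and $S\subseteq R$ the $\mathbb{Z}$-span of $C$. $(R,B)$ is near-integral if it has a fusion subring $(S,C)$ with $|C|+1=|B|$. Then $\rho$ denotes the unique element of $B\setminus C$, $\kappa:=c_{\rho,\rho}^\rho\in\mathbb{Z}_{\geq0}$, $N:=\mathrm{FPdim}(S)$ (an integer), and $R$ is denoted $R(S,\kappa)$; its fusion rules are those of $S$ together with $x\rho=\rho x=\mathrm{FPdim}(x)\rho$ for $x\in C$ and $\rho^2=\kappa\rho+\sum_{x\in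 C}\mathrm{FPdim}(x)x$. $d_+:=\mathrm{FPdim}(\rho)$ is the positive root and $d_-$ the negative root of $x^2-\kappa x-N=0$. Ring homomorphisms are unital. *)

(* Defs.v *)
From HB Require Import structures.
From mathcomp Require Import all_boot all_order all_algebra.
From mathcomp Require Import complex.
From mathcomp Require Import boolp classical_sets reals.

Set Implicit Arguments.
Unset Strict Implicit.
Unset Printing Implicit Defensive.

Import Order.TTheory GRing.Theory Num.Theory.
Local Open Scope classical_set_scope.
Local Open Scope ring_scope.
Local Open Scope complex_scope.

Definition zbasis (A : zmodType) (n : nat) (b : 'I_n -> A) : Prop :=
  forall x : A, exists! a : {ffun 'I_n -> int}, x = \sum_i b i *~ a i.

(* The default value of xget is only reached when x is not in the span of b. *)
Definition coord (A : zmodType) (n : nat) (b : 'I_n -> A) (x : A) :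
    {ffun 'I_n -> int} :=
  xget [ffun=> 0] [set a : {ffun 'I_n -> int} | x = \sum_i b i *~ a i].

Definition antiautomorphism (A : pzRingType) (f : A -> A) : Prop :=
  [/\ bijective f, f 1 = 1, {morph f : x y / x + y} &
      forall x y, f (x * y) = f y * f x].

(* fr_basis enumerates B, and fr_one is the index of 1_R (the index 1 in
   b_1 = 1_R).  fr_coef i j k is c_{ij}^k, uniquely determined by the basis;
   its type nat encodes nonnegativity. *)
Record fusionRing := FusionRing {
  fr_ring :> pzRingType;
  fr_rank : nat;
  fr_basis : 'I_fr_rank -> fr_ring;
  fr_basisP : zbasis fr_basis;
  fr_one : 'I_fr_rank;
  fr_oneE : fr_basis fr_one = 1;
  fr_coef : 'I_fr_rank -> 'I_fr_rank -> 'I_fr_rank -> nat;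
  fr_mulE : forall i j,
    fr_basis i * fr_basis j = \sum_k fr_basis k *+ fr_coef i j k;
  fr_star : 'I_fr_rank -> 'I_fr_rank;
  fr_starK : involutive fr_star;
  fr_star_anti : antiautomorphism (fun x : fr_ring =>
    \sum_j fr_basis (fr_star j) *~ coord fr_basis x j);
  fr_coef_one : forall i j, fr_coef i j fr_one = (i == fr_star j) :> nat
}.

Arguments fr_basis : clear implicits.
Arguments fr_one : clear implicits.
Arguments fr_coef : clear implicits.
Arguments fr_star : clear implicits.

Section FrobeniusPerron.
Variables (K : realType) (F : fusionRing).

Definition coef_mx (i : 'I_(fr_rank F)) : 'M[K]_(fr_rank F) :=
  \matrix_(j, k) (fr_coef F i j k)%:R.

(* FPdim(b_i), as a real number: the maximal real eigenvalue of [c_{ij}^k]_{j,k}.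
   It exists by Perron-Frobenius, so the default value 0 is never used. *)
Definition fpdim (i : 'I_(fr_rank F)) : K :=
  xget 0 [set x : K | eigenvalue (coef_mx i) x /\
                      forall y : K, eigenvalue (coef_mx i) y -> y <= x].

(* FPdim is a ring homomorphism, hence the additive extension of its values on
   the basis. *)
Definition FPdim (x : F) : K[i] :=
  \sum_i (fpdim i)%:C *~ coord (fr_basis F) x i.

Definition FPdim_ring : K := \sum_i fpdim i ^+ 2.

End FrobeniusPerron.

Arguments FPdim_ring : clear implicits.

(* A fusion ring (S, C) with C included in B and S included in R; the two
   inclusions are represented by fs_incl : S -> R and fs_idx : C -> B.
   That S is the Z-span of C and that fs_idx is injective follow. *)
Record fusionSubring (F : fusionRing) := FusionSubring {
  fs_ring :> fusionRing;
  fs_incl : {rmorphism fs_ring -> F};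
  fs_incl_inj : injective fs_incl;
  fs_idx : 'I_(fr_rank fs_ring) -> 'I_(fr_rank F);
  fs_inclE : forall i, fs_incl (fr_basis fs_ring i) = fr_basis F (fs_idx i)
}.

Section NearIntegral.
Variables (K : realType) (F : fusionRing) (S : fusionSubring F).

(* (F, S) exhibits F as a near-integral fusion ring R(S, kappa) and r is the
   index of rho, the unique element of B \ C. *)
Definition near_integral (r : 'I_(fr_rank F)) : Prop :=
  (fr_rank S + 1)%N = fr_rank F /\ r \notin codom (@fs_idx F S).

Variable r : 'I_(fr_rank F).

Definition kappa : nat := fr_coef F r r r.

Definition d_plus : K := fpdim K r.

(* The quadratic has exactly one negative root, since FPdim(S) > 0. *)
Definition d_minus : K :=
  xget 0 [set x : K | x < 0 /\ x ^+ 2 - kappa%:R * x - FPdim_ring K S = 0].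

End NearIntegral.

(* Main.v *)
(* Associativity and the antiautomorphism give Frobenius reciprocity for the
   structure constants, whence x rho = rho x = m(x) rho for x in C, with m
   multiplicative and positive, and rho^2 = kappa rho + sum m(x) x.  By a
   Perron-Frobenius argument, a positive multiplicative function on the basis
   takes the values FPdim, so m = FPdim on S.  A ring homomorphism not killing
   rho is then FPdim on S and sends rho to a root of x^2 - kappa x - N;
   conversely each of the two roots gives a homomorphism, and the one of the
   positive root is FPdim itself. *)
Require Import Defs.
From HB Require Import structures.
From mathcomp Require Import all_boot all_order all_algebra.
From mathcomp Require Import complex.
From mathcomp Require Import boolp classical_sets reals.
From mathcomp Require Import ring lra.

Set Implicit Arguments.
Unset Strict Implicit.
Unset Printing Implicit Defensive.

Import Order.TTheory GRing.Theory Num.Theory.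
Local Open Scope ring_scope.
Local Open Scope complex_scope.

Section ZBasis.
Variables (A : zmodType) (n : nat) (b : 'I_n -> A).
Hypothesis bP : zbasis b.

Lemma zbasis_inj (a a' : 'I_n -> int) :
  \sum_i b i *~ a i = \sum_i b i *~ a' i -> a =1 a'.
Proof.
move=> eq_aa' i; have [c [_ c_uniq]] := bP (\sum_i b i *~ a i).
have ca : c = [ffun i => a i].
  by apply: c_uniq; apply: eq_bigr => j _; rewrite ffunE.
have ca' : c = [ffun i => a' i].
  by apply: c_uniq; rewrite eq_aa'; apply: eq_bigr => j _; rewrite ffunE.
by move: (ca); rewrite ca' => /ffunP/(_ i); rewrite !ffunE.
Qed.

Lemma zcoordK (x : A) : x = \sum_i b i *~ Defs.coord b x i.
Proof.
rewrite /Defs.coord; case: xgetP => [a _ //|no_coord].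
by have [a [xE _]] := bP x; case: (no_coord a).
Qed.

Lemma zcoordE (a : 'I_n -> int) : Defs.coord b (\sum_i b i *~ a i) =1 a.
Proof. by apply: zbasis_inj; rewrite -zcoordK. Qed.

Lemma zcoordB (x y : A) i : Defs.coord b (x - y) i = Defs.coord b x i - Defs.coord b y i.
Proof.
rewrite -[RHS](zcoordE (fun i => Defs.coord b x i - Defs.coord b y i)).
congr (Defs.coord b _ i); rewrite [in LHS](zcoordK x) [in LHS](zcoordK y) -sumrB.
by apply: eq_bigr => j _; rewrite mulrzBr.
Qed.

Lemma zcoord_basis i j : Defs.coord b (b i) j = (j == i)%:R.
Proof.
rewrite -[RHS](zcoordE (fun j => (j == i)%:R)); congr (Defs.coord b _ j).
rewrite (bigD1 i) //= eqxx mulr1z big1 ?addr0 // => k /negbTE->.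
by rewrite mulr0z.
Qed.

Lemma zbasis_fun_inj : injective b.
Proof.
move=> i j bij; have := zcoord_basis i i; rewrite {1}bij zcoord_basis eqxx.
by case: eqP.
Qed.

Lemma additive_eq_basis (V : zmodType) (f g : {additive A -> V}) :
  (forall i, f (b i) = g (b i)) -> f =1 g.
Proof.
move=> fg x; rewrite (zcoordK x) !raddf_sum; apply: eq_bigr => i _.
by rewrite !raddfMz fg.
Qed.

End ZBasis.

Section LinearExtension.
Variables (A : zmodType) (n : nat) (b : 'I_n -> A).

Definition zlinear_ext (bP : zbasis b) (V : zmodType) (f : 'I_n -> V) (x : A) : V :=
  \sum_i f i *~ Defs.coord b x i.

Variables (bP : zbasis b) (V : zmodType) (f : 'I_n -> V).

Lemma zlinear_ext_additive : zmod_morphism (zlinear_ext bP f).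
Proof.
move=> x y; rewrite /zlinear_ext -sumrB; apply: eq_bigr => i _.
by rewrite (zcoordB bP) mulrzBr.
Qed.

HB.instance Definition _ :=
  GRing.isZmodMorphism.Build A V (zlinear_ext bP f) zlinear_ext_additive.

Lemma zlinear_ext_basis i : zlinear_ext bP f (b i) = f i.
Proof.
rewrite /zlinear_ext (bigD1 i) //= (zcoord_basis bP) eqxx mulr1z.
rewrite big1 ?addr0 // => k /negbTE ki.
by rewrite (zcoord_basis bP) ki mulr0z.
Qed.

End LinearExtension.

(* Pairing a left eigenvector of a nonnegative matrix, taken entrywise in
   absolute value, with a positive right eigenvector bounds its eigenvalue. *)
Lemma eigenvalue_max_pos (K : realFieldType) n (M : 'M[K]_n) (v : 'cV[K]_n)
    (lam : K) :
  (forall i j, 0 <= M i j) -> (forall i, 0 < v i ord0) -> (0 < n)%N ->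
  M *m v = lam *: v ->
  eigenvalue M lam /\ (forall y, eigenvalue M y -> y <= lam).
Proof.
move=> M_ge0 v_gt0 n_gt0 Mv; split.
  rewrite /eigenvalue /eigenspace kermx_eq0 row_free_unit.
  apply/negP => /mulKmx/(_ v); rewrite mulmxBl Mv mul_scalar_mx subrr mulmx0.
  move=> v0; have := v_gt0 (Ordinal n_gt0).
  by rewrite -v0 mxE ltxx.
move=> y /eigenvalueP[u uM u_neq0].
pose w := \sum_j `|u ord0 j| * v j ord0.
have [j0 uj0] : exists j, u ord0 j != 0 by apply/rV0Pn.
have w_gt0 : 0 < w.
  rewrite /w (bigD1 j0) //= ltr_pwDl ?mulr_gt0 ?normr_gt0 //.
  by apply: sumr_ge0 => j _; rewrite mulr_ge0 // ltW.
suff : `|y| * w <= lam * w.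
  by rewrite ler_pM2r // => /(le_trans (ler_norm y)).
rewrite /w mulr_sumr.
apply: (@le_trans _ _ (\sum_j \sum_i `|u ord0 i| * M i j * v j ord0)).
  apply: ler_sum => j _; rewrite mulrA -normrM.
  have /rowP/(_ j) := uM; rewrite !mxE => <-.
  rewrite -mulr_suml ler_wpM2r ?(ltW (v_gt0 _)) //.
  apply: (le_trans (ler_norm_sum _ _ _)); apply: ler_sum => i _.
  by rewrite normrM (ger0_norm (M_ge0 _ _)).
rewrite exchange_big mulr_sumr /=; apply: ler_sum => i _.
have /colP/(_ i) := Mv; rewrite !mxE mulrCA => <-.
by rewrite mulr_sumr; under eq_bigr => j _ do rewrite -mulrA.
Qed.

Section FusionRing.
Variable F : fusionRing.
Local Notation n := (fr_rank F).
Local Notation b := (fr_basis F).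
Local Notation c := (fr_coef F).
Local Notation "1i" := (fr_one F).
Local Notation star := (fr_star F).
Implicit Types i j k l : 'I_n.

Lemma fr_coefE (a : 'I_n -> nat) i j :
  b i * b j = \sum_k b k *+ a k -> c i j =1 a.
Proof.
move=> bbE k; suff /(_ k)[] : (fun k => (c i j k)%:Z) =1 (fun k => (a k)%:Z) by [].
by apply: (zbasis_inj (@fr_basisP F)); rewrite -bbE fr_mulE.
Qed.

Lemma fr_coef_assoc i j k l :
  (\sum_h c i j h * c h k l = \sum_h c j k h * c i h l)%N.
Proof.
have eqb : b i * b j * b k = b i * (b j * b k) by rewrite mulrA.
suff /(_ l)[] : (fun l => Posz (\sum_h c i j h * c h k l)%N) =1
                (fun l => Posz (\sum_h c j k h * c i h l)%N) by [].
apply: (zbasis_inj (@fr_basisP F)); move: eqb; rewrite !fr_mulE.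
rewrite mulr_suml mulr_sumr.
under eq_bigr => h _ do rewrite mulrnAl fr_mulE -sumrMnl.
under [in RHS]eq_bigr => h _ do rewrite mulrnAr fr_mulE -sumrMnl.
rewrite exchange_big [in RHS]exchange_big /= => eqb.
transitivity (\sum_j0 \sum_i0 b j0 *+ c i0 k j0 *+ c i j i0); last rewrite eqb.
  apply: eq_bigr => h _; rewrite -pmulrn -sumrMnr; apply: eq_bigr => h' _.
  by rewrite -mulrnA mulnC.
apply: eq_bigr => h _; rewrite -pmulrn -sumrMnr; apply: eq_bigr => h' _.
by rewrite -mulrnA mulnC.
Qed.

Lemma fr_coef1l i j : c 1i i j = (j == i).
Proof.
apply: (fr_coefE (a := fun j => (j == i) : nat)).
rewrite fr_oneE mul1r (bigD1 i) //= eqxx big1 ?addr0 // => k /negbTE->.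
by rewrite mulr0n.
Qed.

(* Both sides are the coefficient of 1 in [b_i b_j b_k]. *)
Lemma fr_coef_cycle i j k : c i j (star k) = c j k (star i).
Proof.
have := fr_coef_assoc i j k 1i.
rewrite (bigD1 (star k)) //= fr_coef_one eqxx muln1 big1 ?addn0; last first.
  by move=> h /negbTE hk; rewrite fr_coef_one hk muln0.
rewrite (bigD1 (star i)) //= fr_coef_one fr_starK eqxx muln1 big1 ?addn0 //.
move=> h hi; rewrite fr_coef_one -(inv_eq (@fr_starK F)) eq_sym.
by rewrite (negbTE hi) muln0.
Qed.

Lemma fr_coef_star i j k : c i j k = c (star j) (star i) (star k).
Proof.
have [_ _ _ antiM] := fr_star_anti F.
pose phi := zlinear_ext (@fr_basisP F) (b \o star).
have phiM x y : phi (x * y) = phi y * phi x by apply: antiM.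
have eqb : b (star j) * b (star i) = \sum_k b k *+ c i j (star k).
  have := phiM (b i) (b j); rewrite /phi !zlinear_ext_basis /= => <-.
  rewrite fr_mulE raddf_sum (reindex_inj (inv_inj (@fr_starK F))).
  apply: eq_bigr => h _ /=.
  by rewrite raddfMn /= zlinear_ext_basis /= fr_starK.
by rewrite (fr_coefE eqb) fr_starK.
Qed.

Lemma fpdim_pos_weight (K : realType) (f : 'I_n -> K) :
    (forall i, 0 < f i) ->
    (forall i j, \sum_k (c i j k)%:R * f k = f i * f j) ->
  forall i, fpdim K i = f i.
Proof.
move=> f_gt0 fM i.
have [||||ev ev_max] :=
  @eigenvalue_max_pos K n (coef_mx K i) (\col_k f k) (f i).
- by move=> j k; rewrite mxE ler0n.
- by move=> k; rewrite mxE.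
- by case: (i) => m; case: (n).
- apply/colP => j; rewrite !mxE -fM.
  by apply: eq_bigr => k _; rewrite !mxE.
rewrite /fpdim; case: xgetP => [x _ [x_ev x_max]|no_max].
  by apply/le_anti; rewrite ev_max //= x_max.
by case: (no_max (f i)).
Qed.

Lemma weight_rmorphism (R : pzRingType) (f : 'I_n -> R) :
    f 1i = 1 -> (forall i j, \sum_k f k *+ c i j k = f i * f j) ->
  exists chi : {rmorphism F -> R}, forall i, chi (b i) = f i.
Proof.
move=> f1 fM; pose phi := zlinear_ext (@fr_basisP F) f.
have phiM : monoid_morphism phi.
  split=> [|x y]; first by rewrite /phi -fr_oneE zlinear_ext_basis.
  rewrite (zcoordK (@fr_basisP F) x) (zcoordK (@fr_basisP F) y).
  rewrite /phi mulr_suml !raddf_sum mulr_suml; apply: eq_bigr => i _.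
  rewrite mulr_sumr !raddf_sum mulr_sumr; apply: eq_bigr => j _.
  rewrite mulrzAl mulrzAr !raddfMz /= !zlinear_ext_basis mulrzAl mulrzAr.
  congr (_ *~ _ *~ _); rewrite fr_mulE raddf_sum -fM; apply: eq_bigr => k _.
  by rewrite raddfMn /= zlinear_ext_basis.
pose phiZ := GRing.isZmodMorphism.Build F R phi
  (@zlinear_ext_additive _ _ _ (@fr_basisP F) _ f).
pose phiMm := GRing.isMonoidMorphism.Build F R phi phiM.
pose chi : {rmorphism F -> R} := HB.pack phi phiZ phiMm.
by exists chi => i; apply: zlinear_ext_basis.
Qed.

End FusionRing.

Section NearIntegralFusionRules.
Variables (F : fusionRing) (S : fusionSubring F) (r : 'I_(fr_rank F)).
Hypothesis hR : near_integral S r.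
Local Notation b := (fr_basis F).
Local Notation c := (fr_coef F).
Local Notation "1i" := (fr_one F).
Local Notation star := (fr_star F).
Local Notation idx := (@fs_idx F S).
(* By the fusion rules proved below, [m x] is the integer by which x acts
   on rho; it turns out to be FPdim(x). *)
Local Notation m i := (c i r r).

Lemma fs_idx_inj : injective idx.
Proof.
move=> i j eq_ij; apply: (zbasis_fun_inj (@fr_basisP S)).
by apply: (@fs_incl_inj F S); rewrite !fs_inclE eq_ij.
Qed.

Lemma fs_idx_neq s : idx s != r.
Proof. by case: hR => _; apply: contraNneq => <-; apply: codom_f. Qed.

Lemma fs_idx_imset : idx @: finset.setT = [set~ r].
Proof.
apply/eqP; rewrite eqEcard; apply/andP; split.
  by apply/fintype.subsetP => _ /imsetP[s _ ->]; rewrite !inE fs_idx_neq.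
rewrite card_imset; last exact: fs_idx_inj.
by rewrite cardsC1 finset.cardsT !card_ord -(proj1 hR) addn1.
Qed.

Lemma fs_idx_surj i : i != r -> exists s, i = idx s.
Proof.
move=> i_neq_r; have /imsetP[s _ ->] : i \in idx @: finset.setT.
  by rewrite fs_idx_imset !inE.
by exists s.
Qed.

Lemma near_integral_sum (V : nmodType) (G : 'I_(fr_rank F) -> V) :
  \sum_i G i = G r + \sum_s G (idx s).
Proof.
rewrite (bigD1 r) //=; congr (_ + _).
transitivity (\sum_(i in idx @: finset.setT) G i).
  by apply: eq_bigl => i; rewrite fs_idx_imset !inE.
rewrite big_imset /=; last by move=> ? ? _ _; apply: fs_idx_inj.
by apply: eq_bigl => s; rewrite inE.
Qed.

Lemma fs_coef_idx i j k :
  c (idx i) (idx j) k = (\sum_(l | idx l == k) fr_coef S i j l)%N.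
Proof.
apply: (fr_coefE (a := fun k => (\sum_(l | idx l == k) fr_coef S i j l)%N)).
rewrite -!fs_inclE -rmorphM fr_mulE raddf_sum /=.
under [RHS]eq_bigr => h _ do rewrite -sumrMnr.
rewrite (exchange_big_dep predT) //=; apply: eq_bigr => l _.
by rewrite raddfMn /= fs_inclE (big_pred1 (idx l)) // => h; rewrite /= eq_sym.
Qed.

Lemma fs_coefE i j k : c (idx i) (idx j) (idx k) = fr_coef S i j k.
Proof.
by rewrite fs_coef_idx (big_pred1 k) // => l; rewrite (inj_eq fs_idx_inj).
Qed.

Lemma fs_coef_closed i j : i != r -> j != r -> c i j r = 0%N.
Proof.
move=> /fs_idx_surj[s ->] /fs_idx_surj[t ->].
by rewrite fs_coef_idx big_pred0 // => l; apply/negbTE/fs_idx_neq.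
Qed.

Lemma fs_idx_one : idx (fr_one S) = 1i.
Proof.
apply: (zbasis_fun_inj (@fr_basisP F)).
by rewrite -fs_inclE !fr_oneE rmorph1.
Qed.

Lemma fs_idx_star i : star (idx i) = idx (fr_star S i).
Proof.
have := fs_coefE i (fr_star S i) (fr_one S).
rewrite fs_idx_one !fr_coef_one fr_starK eqxx.
by case: eqP => [->|//]; rewrite fr_starK.
Qed.

Lemma fr_one_neq : 1i != r.
Proof. by rewrite -fs_idx_one fs_idx_neq. Qed.

Lemma star_neq i : i != r -> star i != r.
Proof. by move=> /fs_idx_surj[s ->]; rewrite fs_idx_star fs_idx_neq. Qed.

Lemma star_rho : star r = r.
Proof.
apply/eqP; apply: contraT => /star_neq.
by rewrite fr_starK eqxx.
Qed.

Lemma coef_mulr_rho i k : i != r -> k != r -> c i r k = 0%N.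
Proof.
move=> ir kr; rewrite -[k](@fr_starK F) -fr_coef_cycle star_rho.
by rewrite fs_coef_closed ?star_neq.
Qed.

Lemma coef_mull_rho i k : i != r -> k != r -> c r i k = 0%N.
Proof.
move=> ir kr; rewrite -[k](@fr_starK F) fr_coef_cycle star_rho.
by rewrite fs_coef_closed ?star_neq.
Qed.

Lemma coef_rho_mull i : c r i r = m i.
Proof. by rewrite -{2}star_rho fr_coef_cycle star_rho. Qed.

Lemma coef_rho_sqr i : c r r i = m i.
Proof. by rewrite fr_coef_star star_rho fr_coef_cycle star_rho coef_rho_mull. Qed.

Lemma rho_weightM i j : i != r -> j != r ->
  (\sum_k c i j k * m k = m i * m j)%N.
Proof.
move=> ir jr; rewrite fr_coef_assoc (bigD1 r) //= big1 ?addn0 1?mulnC //.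
by move=> k kr; rewrite coef_mulr_rho.
Qed.

Lemma rho_weight_one : m 1i = 1%N.
Proof. by rewrite fr_coef1l eqxx. Qed.

Lemma rho_weight_gt0 i : i != r -> (0 < m i)%N.
Proof.
move=> ir; rewrite lt0n; apply: contraNneq fr_one_neq => mi0.
have := rho_weightM ir (star_neq ir); rewrite mi0 mul0n (bigD1 1i) //=.
by rewrite fr_coef_one fr_starK eqxx rho_weight_one.
Qed.

Definition ext_weight (R : pzRingType) (d : R) i : R :=
  if i == r then d else (m i)%:R.

Lemma ext_weight_rho (R : pzRingType) (d : R) : ext_weight d r = d.
Proof. by rewrite /ext_weight eqxx. Qed.

Lemma ext_weight_idx (R : pzRingType) (d : R) s :
  ext_weight d (idx s) = (m (idx s))%:R.
Proof. by rewrite /ext_weight (negbTE (fs_idx_neq s)). Qed.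

Lemma ext_weightM (R : pzRingType) (d : R) :
    d * d = d *+ kappa r + \sum_s (m (idx s))%:R ^+ 2 ->
  forall i j, \sum_k ext_weight d k *+ c i j k = ext_weight d i * ext_weight d j.
Proof.
move=> dd i j; have [->|ir] := eqVneq i r; have [->|jr] := eqVneq j r.
- rewrite near_integral_sum !ext_weight_rho dd; congr (_ + _).
  by apply: eq_bigr => s _; rewrite ext_weight_idx coef_rho_sqr expr2 mulr_natr.
- rewrite near_integral_sum big1 ?addr0 => [|s _]; last first.
    by rewrite coef_mull_rho ?fs_idx_neq.
  by rewrite !ext_weight_rho coef_rho_mull /ext_weight (negbTE jr) mulr_natr.
- rewrite near_integral_sum big1 ?addr0 => [|s _]; last first.
    by rewrite coef_mulr_rho ?fs_idx_neq.
  by rewrite !ext_weight_rho /ext_weight (negbTE ir) mulr_natl.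
rewrite {2 3}/ext_weight (negbTE ir) (negbTE jr) -natrM -rho_weightM // natr_sum.
apply: eq_bigr => k _; rewrite /ext_weight; case: eqVneq => [->|_].
  by rewrite fs_coef_closed.
by rewrite mulnC natrM mulr_natr.
Qed.

Lemma fpdim_idx (K : realType) s : fpdim K s = (m (idx s))%:R.
Proof.
apply: (fpdim_pos_weight (f := fun s => (m (idx s))%:R)) => [i|i j].
  by rewrite ltr0n rho_weight_gt0 ?fs_idx_neq.
rewrite -natrM -rho_weightM ?fs_idx_neq // natr_sum near_integral_sum.
rewrite fs_coef_closed ?fs_idx_neq // mul0n add0r.
by apply: eq_bigr => k _; rewrite fs_coefE natrM.
Qed.

Lemma FPdim_ringE (K : realType) : FPdim_ring K S = \sum_s (m (idx s))%:R ^+ 2.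
Proof. by apply: eq_bigr => s _; rewrite fpdim_idx. Qed.

Lemma FPdim_ring_gt0 (K : realType) : 0 < FPdim_ring K S.
Proof.
rewrite FPdim_ringE (bigD1 (fr_one S)) //= fs_idx_one rho_weight_one.
by rewrite ltr_pwDl ?expr1n // sumr_ge0 // => s _; rewrite exprn_ge0.
Qed.

Lemma char_idx (R : idomainType) (chi : {rmorphism F -> R}) s :
  chi (b r) != 0 -> chi (b (idx s)) = (m (idx s))%:R.
Proof.
move=> chi_r; apply: (mulIf chi_r); rewrite -rmorphM fr_mulE near_integral_sum.
rewrite big1 ?addr0 => [|t _]; last by rewrite coef_mulr_rho ?fs_idx_neq.
by rewrite raddfMn /= mulr_natl.
Qed.

Lemma char_rho_sqr (R : idomainType) (chi : {rmorphism F -> R}) :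
    chi (b r) != 0 ->
  chi (b r) ^+ 2 = chi (b r) *+ kappa r + \sum_s (m (idx s))%:R ^+ 2.
Proof.
move=> chi_r; rewrite expr2 -rmorphM fr_mulE near_integral_sum raddfD /= raddfMn /=.
congr (_ + _); rewrite raddf_sum; apply: eq_bigr => s _ /=.
by rewrite raddfMn /= char_idx // coef_rho_sqr expr2 mulr_natr.
Qed.

Lemma char_eq (R : idomainType) (chi chi' : {rmorphism F -> R}) :
    chi (b r) != 0 -> chi' (b r) = chi (b r) -> chi =1 chi'.
Proof.
move=> chi_r chi'r; apply: (additive_eq_basis (@fr_basisP F)) => i.
have [->|/fs_idx_surj[s ->]] := eqVneq i r; first exact: esym.
by rewrite /= !char_idx ?chi'r.
Qed.

Lemma char_FPdim (K : realType) (chi : {rmorphism F -> K[i]}) (s : S) :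
  chi (b r) != 0 -> chi (fs_incl S s) = FPdim K s.
Proof.
move=> chi_r.
suff /(_ s) : (chi \o fs_incl S) =1
    zlinear_ext (@fr_basisP S) (fun i => (fpdim K i)%:C) by [].
apply: (additive_eq_basis (@fr_basisP S)) => i.
by rewrite /= zlinear_ext_basis fs_inclE char_idx // fpdim_idx rmorph_nat.
Qed.

Lemma exists_char (K : realType) (d : K) :
    d ^+ 2 = (kappa r)%:R * d + FPdim_ring K S ->
  exists chi : {rmorphism F -> K[i]}, chi (b r) = d%:C.
Proof.
move=> dd; have [||chi chiE] := @weight_rmorphism F K[i] (ext_weight d%:C).
- by rewrite -fs_idx_one ext_weight_idx fs_idx_one rho_weight_one.
- apply: ext_weightM; rewrite -rmorphM -expr2 dd rmorphD rmorphM /= rmorph_nat.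
  rewrite mulr_natl FPdim_ringE rmorph_sum; congr (_ + _).
  by apply: eq_bigr => s _; rewrite rmorphXn /= rmorph_nat.
by exists chi; rewrite chiE ext_weight_rho.
Qed.

Lemma d_plusE (K : realType) (d : K) :
  0 < d -> d ^+ 2 = (kappa r)%:R * d + FPdim_ring K S -> d_plus K r = d.
Proof.
move=> d_gt0 dd; rewrite -[RHS]ext_weight_rho.
apply: fpdim_pos_weight => [i|i j].
  rewrite /ext_weight; case: eqVneq => // ir.
  by rewrite ltr0n rho_weight_gt0.
rewrite -ext_weightM; first by apply: eq_bigr => k _; rewrite mulr_natl.
by rewrite -expr2 dd mulr_natl FPdim_ringE.
Qed.

End NearIntegralFusionRules.

Theorem proposition3p3 (K : realType) (F : fusionRing) (S : fusionSubring F)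
    (r : 'I_(fr_rank F)) (hR : near_integral S r) :
  exists chi_p chi_m : {rmorphism F -> K[i]},
    [/\ ~ (chi_p =1 chi_m),
        forall chi : {rmorphism F -> K[i]},
          chi (fr_basis F r) != 0 <-> (chi =1 chi_p \/ chi =1 chi_m),
        forall s : S, chi_p (fs_incl S s) = FPdim K s
                   /\ chi_m (fs_incl S s) = FPdim K s,
        chi_p (fr_basis F r) = (d_plus K r)%:C &
        chi_m (fr_basis F r) = (d_minus K S r)%:C].
Proof.
have N_gt0 := FPdim_ring_gt0 hR K.
set N := FPdim_ring K S in N_gt0; pose k : K := (kappa r)%:R.
have k_ge0 : 0 <= k by apply: ler0n.
pose q := Num.sqrt (k ^+ 2 + 4 * N).
have disc_ge0 : 0 <= k ^+ 2 + 4 * N by nra.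
have qq : q ^+ 2 = k ^+ 2 + 4 * N by apply: sqr_sqrtr.
have NE : N = (q ^+ 2 - k ^+ 2) / 4 by rewrite qq; field.
have q_ge0 : 0 <= q by apply: sqrtr_ge0.
have k_lt_q : k < q by nra.
pose dp := (k + q) / 2; pose dm := (k - q) / 2.
have dp_gt0 : 0 < dp by rewrite /dp; lra.
have dm_lt0 : dm < 0 by rewrite /dm; lra.
have dpE : dp ^+ 2 = k * dp + N by rewrite NE /dp; field.
have dmE : dm ^+ 2 = k * dm + N by rewrite NE /dm; field.
have d_roots x : x ^+ 2 - k * x - N = (x - dp) * (x - dm) by rewrite NE /dp /dm; field.
have d_minusE : d_minus K S r = dm.
  rewrite /d_minus; case: xgetP => [x _ [x_lt0 /eqP]|no_root].
    rewrite d_roots mulf_eq0 !subr_eq0 => /orP[] /eqP // xE.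
    by move: x_lt0; rewrite xE ltNge ltW.
  by case: (no_root dm); split=> //; rewrite d_roots subrr mulr0.
have [chi_p chi_pE] := exists_char hR dpE.
have [chi_m chi_mE] := exists_char hR dmE.
have chi_p_neq0 : chi_p (fr_basis F r) != 0.
  by rewrite chi_pE fmorph_eq0 gt_eqF.
have chi_m_neq0 : chi_m (fr_basis F r) != 0.
  by rewrite chi_mE fmorph_eq0 lt_eqF.
exists chi_p, chi_m; split.
- move=> /(_ (fr_basis F r)); rewrite chi_pE chi_mE => /(fmorph_inj _) dpm.
  by move: dp_gt0; rewrite dpm ltNge ltW.
- move=> chi; split=> [chi_r|[] ->] //.
  have: (chi (fr_basis F r) - dp%:C) * (chi (fr_basis F r) - dm%:C) = 0.
    have factorE (x : K[i]) (u v : K) :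
        (x - u%:C) * (x - v%:C) = x ^+ 2 - x * (u + v)%:C + (u * v)%:C.
      by rewrite rmorphD rmorphM /=; ring.
    rewrite factorE.
    have -> : dp + dm = k by rewrite /dp /dm; field.
    have -> : dp * dm = - N by rewrite NE /dp /dm; field.
    rewrite (char_rho_sqr hR) // rmorphN /= rmorph_nat mulr_natr (addrC (_ *+ _)) addrK.
    rewrite /N (FPdim_ringE hR) rmorph_sum /=; apply/eqP; rewrite subr_eq0; apply/eqP.
    by apply: eq_bigr => s _; rewrite rmorphXn /= rmorph_nat.
  move=> /eqP; rewrite mulf_eq0 !subr_eq0 => /orP[] /eqP chiE; [left|right];
    by apply: (char_eq hR); rewrite // chiE.
- by move=> s; rewrite !(char_FPdim hR).
- by rewrite chi_pE (d_plusE hR dp_gt0 dpE).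
- by rewrite chi_mE d_minusE.
Qed.
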